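(* In Morpion Solitaire 5D, starting from the standard initial configuration, the number of moves in any play cannot exceed $136$.
   Context: Morpion Solitaire 5D is a one-player game on the integer lattice $\mathbb{Z}^2$. Initially there are 36 crosses, placed on the lattice points lying on the boundary of the 12-sided polygon (a ''Greek cross'') with consecutive vertices $(3,0),(6,0),(6,3),(9,3),(9,6),(6,6),(6,9),(3,9),(3,6),(0,6),(0,3),(3,3)$; each of its 12 edges contains exactly 4 lattice points. A move consists of: (1) placing a new cross on a lattice point that currently has no cross; (2) drawing a line, i.e. a segment covering exactly 5 consecutive lattice points in one of the four directions (horizontal, vertical, or one of the two diagonals), such that all 5 covered points carry crosses and one of them is the cross placed in step (1). In the 5D variant, a newly drawn line may not share any lattice point with a previously drawn line of the same direction. The game is a sequence of legal moves; its score is the number of moves. *)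

(* Defs.v *)
From HB Require Import structures.
From mathcomp Require Import all_boot all_order all_algebra.

Set Implicit Arguments.
Unset Strict Implicit.
Unset Printing Implicit Defensive.

Import Order.TTheory GRing.Theory Num.Theory.
Local Open Scope ring_scope.

Definition point : Type := (int * int)%type.

Inductive direction : Type := Horizontal | Vertical | Diagonal | Antidiagonal.

Definition code_direction (d : direction) : bool * bool :=
  match d with
  | Horizontal => (false, false)
  | Vertical => (false, true)
  | Diagonal => (true, false)
  | Antidiagonal => (true, true)
  end.

Definition decode_direction (b : bool * bool) : direction :=
  match b with
  | (false, false) => Horizontal
  | (false, true) => Vertical
  | (true, false) => Diagonal
  | (true, true) => Antidiagonal
  end.

Lemma code_directionK : cancel code_direction decode_direction.
Proof. by case. Qed.

HB.instance Definition _ := Finite.copy direction (can_type code_directionK).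

Definition step (d : direction) : point :=
  match d with
  | Horizontal => (1, 0)
  | Vertical => (0, 1)
  | Diagonal => (1, 1)
  | Antidiagonal => (1, -1)
  end.

(* Since [step] fixes one of the two orientations of each direction, every
   segment of 5 consecutive lattice points has exactly one representation,
   given by the endpoint from which the steps start. *)
Record line : Type := Line { line_start : point; line_dir : direction }.

Definition line_points (l : line) : seq point :=
  [seq line_start l + step (line_dir l) *+ k | k <- iota 0 5].

Definition greek_cross_vertices : seq point :=
  [:: (3, 0); (6, 0); (6, 3); (9, 3); (9, 6); (6, 6);
      (6, 9); (3, 9); (3, 6); (0, 6); (0, 3); (3, 3)].

Definition greek_cross_edges : seq (point * point) :=
  zip greek_cross_vertices (rot 1 greek_cross_vertices).

Definition on_segment (e : point * point) (p : point) : bool :=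
  let: (a, b) := e in
  [&& (b.1 - a.1) * (p.2 - a.2) == (b.2 - a.2) * (p.1 - a.1),
      Num.min a.1 b.1 <= p.1 <= Num.max a.1 b.1 &
      Num.min a.2 b.2 <= p.2 <= Num.max a.2 b.2].

Definition initial_cross (p : point) : bool :=
  has (fun e => on_segment e p) greek_cross_edges.

Record move : Type := Move { new_cross : point; new_line : line }.

Definition has_cross (played : seq move) (p : point) : bool :=
  initial_cross p || (p \in map new_cross played).

Definition legal_move (played : seq move) (m : move) : bool :=
  [&& ~~ has_cross played (new_cross m),
      new_cross m \in line_points (new_line m),
      all (has_cross (rcons played m)) (line_points (new_line m)) &
      all (fun l => (line_dir l == line_dir (new_line m)) ==>
                    ~~ has (mem (line_points l)) (line_points (new_line m)))
          (map new_line played)].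

(* The moves of a play are listed in chronological order. *)
Inductive play : seq move -> Prop :=
| play_start : play [::]
| play_move s m : play s -> legal_move s m -> play (rcons s m).

Definition initial_crosses : seq point :=
  [seq p <- [seq (Posz x, Posz y) | x <- iota 0 10, y <- iota 0 10]
     | initial_cross p].

Lemma size_initial_crosses : size initial_crosses = 36%N.
Proof. by vm_compute. Qed.

Lemma uniq_initial_crosses : uniq initial_crosses.
Proof. by vm_compute. Qed.

Lemma mem_initial_crosses p : (p \in initial_crosses) = initial_cross p.
Proof.
rewrite mem_filter andb_idr //; case: p => x y p_init.
have /andP[/andP[x0 x9] /andP[y0 y9]] : (0 <= x <= 9) && (0 <= y <= 9).
  have /allP in_box : all (fun e : point * point =>
      [&& 0 <= Num.min e.1.1 e.2.1, Num.max e.1.1 e.2.1 <= 9,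
          0 <= Num.min e.1.2 e.2.2 & Num.max e.1.2 e.2.2 <= 9])
      greek_cross_edges by vm_compute.
  have /hasP[[a b] /in_box/and4P[/= a0 a9 b0 b9]] := p_init.
  case/and3P=> _ /andP[ax xa] /andP[by_ yb].
  by rewrite (le_trans a0 ax) (le_trans xa a9) (le_trans b0 by_) (le_trans yb b9).
case: x y x0 x9 y0 y9 {p_init} => // x [] // y _ x9 _ y9.
by apply: allpairs_f; rewrite mem_iota.
Qed.

Lemma count_greek_cross_edges :
  all (fun e => count (on_segment e) initial_crosses == 4%N) greek_cross_edges.
Proof. by vm_compute. Qed.

(* Main.v *)
Require Import Defs.
From mathcomp Require Import all_boot all_order all_algebra.
From mathcomp Require Import zify.

(** Call a pair (cross, direction) a slot.  After N moves there are 4 (36 + N)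
    slots, and the lines occupy 5 N distinct ones.  The four crosses placed last
    use at most 8 of their 16 slots: a line cannot contain crosses placed later,
    and two lines share at most one point, so among the six pairs of these
    crosses at most four have the later one's line through the earlier one.
    Hence 5 N <= 4 (36 + N) - 8. *)

Set Implicit Arguments.
Unset Strict Implicit.
Unset Printing Implicit Defensive.

Import GRing.Theory.

Lemma countC_mem (T : eqType) (s t : seq T) : uniq s -> uniq t ->
  count (mem t) s = count (mem s) t.
Proof.
move=> us ut; rewrite -!size_filter; apply/perm_size/uniq_perm.
- exact: filter_uniq.
- exact: filter_uniq.
by move=> x; rewrite !mem_filter andbC.
Qed.

Lemma step_mulrn (a : point) (d : direction) (k : nat) :
  (a + step d *+ k = (a.1 + (step d).1 * k%:Z, a.2 + (step d).2 * k%:Z))%R.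
Proof.
case: a (step d) => a b [x y].
have -> : ((x, y) *+ k = (x *+ k, y *+ k))%R.
  by elim: k => // k IHk; rewrite !mulrS IHk.
by rewrite -!natz !mulr_natr.
Qed.

Lemma uniq_line_points (l : line) : uniq (line_points l).
Proof.
case: l => [a d]; rewrite map_inj_uniq ?iota_uniq // => i j /=.
by rewrite !step_mulrn; case: d => -[] /=; lia.
Qed.

(** On each line, [q - p] is a nonzero multiple of the step of its direction, and the four steps are
    pairwise non-parallel. *)
Lemma line_dir_two_points (l l' : line) (p q : point) : p != q ->
  p \in line_points l -> q \in line_points l ->
  p \in line_points l' -> q \in line_points l' -> line_dir l = line_dir l'.
Proof.
case: l l' p q => [[ax ay] d] [[bx by_] d'] [px py] [qx qy].
rewrite xpair_eqE => /= neq_pq.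
case/mapP=> /= i _; rewrite step_mulrn => -[pxi pyi].
case/mapP=> /= j _; rewrite step_mulrn => -[qxj qyj].
case/mapP=> /= i' _; rewrite step_mulrn => -[pxi' pyi'].
case/mapP=> /= j' _; rewrite step_mulrn => -[qxj' qyj'].
by case: d d' pxi pyi qxj qyj pxi' pyi' qxj' qyj' => -[] //=; lia.
Qed.

(** A second common point would force equal directions, and then the 5D rule forbids even the common
    point [p]. *)
Lemma compatible_lines_share_one_point (l l' : line) (p q : point) : p != q ->
  (line_dir l == line_dir l') ==>
    ~~ has (mem (line_points l)) (line_points l') ->
  ~~ [&& p \in line_points l, q \in line_points l,
         p \in line_points l' & q \in line_points l'].
Proof.
move=> neq_pq compat; apply/and4P=> -[pl ql pl' ql'].
move: compat; rewrite (line_dir_two_points neq_pq pl ql pl' ql') eqxx implyTb.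
by case/hasP; exists p.
Qed.

Lemma has_cross_rcons (s : seq move) (m : move) (p : point) :
  has_cross (rcons s m) p = (p == new_cross m) || has_cross s p.
Proof. by rewrite /has_cross map_rcons mem_rcons inE orbCA. Qed.

Lemma play_rcons (s : seq move) (m : move) :
  play (rcons s m) -> play s /\ legal_move s m.
Proof.
move Et: (rcons s m) => t pt; case: pt Et => [|s' m' ps' lm'].
  by case: s.
by move/rcons_inj=> [-> ->].
Qed.

Definition slots (l : line) : seq (point * direction) :=
  [seq (p, line_dir l) | p <- line_points l].

Definition used_slots (s : seq move) : seq (point * direction) :=
  flatten [seq slots (new_line m) | m <- s].

Lemma used_slots_rcons (s : seq move) (m : move) :
  used_slots (rcons s m) = used_slots s ++ slots (new_line m).
Proof. by rewrite /used_slots map_rcons flatten_rcons. Qed.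

Lemma size_used_slots (s : seq move) : size (used_slots s) = 5 * size s.
Proof.
elim/last_ind: s => // s m IHs.
by rewrite used_slots_rcons size_cat IHs !size_map size_iota size_rcons mulnS addnC.
Qed.

Lemma uniq_slots (l : line) : uniq (slots l).
Proof. by rewrite map_inj_uniq ?uniq_line_points // => p q []. Qed.

Lemma used_slots_has_cross (s : seq move) (x : point * direction) :
  play s -> x \in used_slots s -> has_cross s x.1.
Proof.
move=> ps; elim: ps => {s} // s m _ IHs /and4P[_ _ /allP in_cross _].
rewrite used_slots_rcons mem_cat => /orP[/IHs|/mapP[p /in_cross ? ->] //].
by rewrite has_cross_rcons orbC => ->.
Qed.

(** A slot remembers its direction, so a reused slot would be a common point of two lines of the
    same direction, which the 5D rule excludes. *)
Lemma compatible_slots_unused (s : seq move) (l : line) (x : point * direction) :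
  all (fun l' => (line_dir l' == line_dir l) ==>
                   ~~ has (mem (line_points l')) (line_points l))
      (map new_line s) ->
  x \in slots l -> x \notin used_slots s.
Proof.
move=> + /mapP[p pl ->].
elim: s => // m s IHs /andP[compat /IHs notin_s].
rewrite mem_cat (negbTE notin_s) orbF.
apply/mapP=> -[q ql [eq_pq eq_dir]].
move: compat; rewrite eq_dir eqxx => /negP; apply.
by apply/hasP; exists p => //; rewrite inE eq_pq.
Qed.

Lemma uniq_used_slots (s : seq move) : play s -> uniq (used_slots s).
Proof.
elim=> {s} // s m _ IHs /and4P[_ _ _ compat].
rewrite used_slots_rcons cat_uniq IHs uniq_slots andbT andTb.
by apply/hasPn=> x /(compatible_slots_unused compat).
Qed.

Lemma count_slots (Q : seq point) (l : line) : uniq Q ->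
  count (fun x => x.1 \in Q) (slots l) = count (mem (line_points l)) Q.
Proof. by move=> uQ; rewrite count_map countC_mem // uniq_line_points. Qed.

Lemma count_used_slots (s : seq move) (Q : seq point) : play s ->
  {in Q, forall p, ~~ has_cross s p} ->
  count (fun x => x.1 \in Q) (used_slots s) = 0.
Proof.
move=> ps notQ; apply/eqP; rewrite -leqn0 leqNgt -has_count; apply/hasPn=> x.
by move/(used_slots_has_cross ps); apply: contraL => /notQ.
Qed.

(** [X] embeds into the product of the 36 initial and [size s] played crosses with the four
    directions. *)
Lemma has_cross_bound (s : seq move) (X : seq (point * direction)) :
  uniq X -> {in X, forall x, has_cross s x.1} -> size X <= 4 * (36 + size s).
Proof.
move=> uX sX; pose ds := [:: Horizontal; Vertical; Diagonal; Antidiagonal].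
pose cs := initial_crosses ++ map new_cross s.
have -> : 4 * (36 + size s) = size [seq (p, d) | p <- cs, d <- ds].
  by rewrite size_allpairs size_cat size_initial_crosses size_map mulnC.
apply: (uniq_leq_size uX) => -[p d] /sX sp.
apply/allpairsP; exists (p, d); split=> //; last by case: (d).
by rewrite mem_cat mem_initial_crosses.
Qed.

Theorem theorem3 (s : seq move) (hs : play s) : (size s <= 136)%N.
Proof.
(* Plays of fewer than four moves satisfy the bound trivially. Otherwise the last four moves are
   peeled off, [m1] being the very last. *)
case/lastP: s hs => [|s m1] //.
case/lastP: s => [|s m2] //.
case/lastP: s => [|s m3] //.
case/lastP: s => [|s m4] // ps1; rewrite !size_rcons.
have [ps2 /and4P[new1 q1l1 _ compat1]] := play_rcons ps1.
have [ps3 /and4P[new2 q2l2 /allP cross2 _]] := play_rcons ps2.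
have [ps4 /and4P[new3 q3l3 /allP cross3 _]] := play_rcons ps3.
have [ps5 /and4P[new4 q4l4 /allP cross4 _]] := play_rcons ps4.
set q1 := new_cross m1 in new1 q1l1.
set q2 := new_cross m2 in new2 q2l2.
set q3 := new_cross m3 in new3 q3l3.
set q4 := new_cross m4 in new4 q4l4.
set l1 := new_line m1 in q1l1 compat1.
set l2 := new_line m2 in q2l2 cross2.
set l3 := new_line m3 in q3l3 cross3.
set l4 := new_line m4 in q4l4 cross4.
(* All points of a line carry crosses once it is drawn, and crosses persist, so a cross placed later
   cannot lie on it. *)
have q1l2 : q1 \notin line_points l2 by apply: contra new1; apply: cross2.
have q2l3 : q2 \notin line_points l3 by apply: contra new2; apply: cross3.
have q3l4 : q3 \notin line_points l4 by apply: contra new3; apply: cross4.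
have q1l3 : q1 \notin line_points l3.
  by apply: contra new1 => /cross3 c; rewrite has_cross_rcons c orbT.
have q2l4 : q2 \notin line_points l4.
  by apply: contra new2 => /cross4 c; rewrite has_cross_rcons c orbT.
have q1l4 : q1 \notin line_points l4.
  apply: contra new1 => /cross4 c.
  by rewrite 2!(has_cross_rcons (rcons _ _)) c !orbT.
move: new1 new2 new3; rewrite !has_cross_rcons -/q2 -/q3 -/q4.
case/norP=> n12 /norP[n13 /norP[n14 new1]].
case/norP=> n23 /norP[n24 new2] /norP[n34 new3].
pose Q := [:: q1; q2; q3; q4].
have uQ : uniq Q by rewrite /= !inE !negb_or n12 n13 n14 n23 n24 n34.
pose late := fun x : point * direction => x.1 \in Q.
set X := used_slots (rcons (rcons (rcons (rcons s m4) m3) m2) m1).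
have late_bound : count late X <= 8.
  (* The lines of [s] miss [Q], whose points are still empty then. What remains is a 4 by 4
     incidence table: four entries hold, six fail, and six are open. *)
  rewrite /X !used_slots_rcons !count_cat !count_slots // count_used_slots //.
    rewrite -/l1 -/l2 -/l3 -/l4 /= q1l1 q2l2 q3l3 q4l4.
    rewrite (negbTE q1l2) (negbTE q1l3) (negbTE q1l4).
    rewrite (negbTE q2l3) (negbTE q2l4) (negbTE q3l4).
    move: compat1; rewrite !map_rcons !all_rcons -/l2 -/l3 -/l4.
    case/and4P=> compat12 compat13 _ _.
    (* Five incidences among the six pairs would violate one of these three. *)
    have := compatible_lines_share_one_point n23 compat12.
    have := compatible_lines_share_one_point n24 compat12.
    have := compatible_lines_share_one_point n34 compat13.
    rewrite q2l2 q3l3; do !case: (_ \in line_points _) => //.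
  by move=> p; rewrite !inE => /or4P[]/eqP->.
(* A used slot outside [Q] sits on a cross already present after [s]. *)
have early_bound : count (predC late) X <= 4 * (36 + size s).
  rewrite -size_filter; apply: has_cross_bound.
    exact/filter_uniq/uniq_used_slots.
  move=> x; rewrite mem_filter => /andP[].
  rewrite /= /late /Q !inE => /norP[x1 /norP[x2 /norP[x3 x4]]].
  move/(used_slots_has_cross ps1); rewrite !has_cross_rcons.
  by rewrite (negbTE x1) (negbTE x2) (negbTE x3) (negbTE x4).
(* With [n = size s], this gives [5 (n + 4) <= 8 + 4 (36 + n)], hence [n <= 132] and
   [n + 4 <= 136]. *)
have := size_used_slots (rcons (rcons (rcons (rcons s m4) m3) m2) m1).
by rewrite -/X -(count_predC late) !size_rcons; move: late_bound early_bound; clear; lia.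
Qed.
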